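(* Let $A$ be a local non-semisimple finite dimensional Hopf algebra over a field $K$. Then $\Delta_A=1$; that is, $\operatorname{Ext}^1_A(M,M)\neq 0$ for every finite dimensional non-projective $A$-module $M$.
   Context: Modules are finite dimensional right modules. For a module $M$ over a finite dimensional algebra $A$, $\phi_M:=\inf\{r\geq 1\mid \operatorname{Ext}^r_A(M,M)\neq 0\}$ with $\inf(\emptyset)=\infty$. Finite dimensional Hopf algebras are selfinjective, and for a selfinjective algebra $A$ one has $\Delta_A=\sup\{\phi_M\mid M \text{ a non-projective } A\text{-module}\}$. *)

(* Defs.v *)
From HB Require Import structures.
From mathcomp Require Import all_boot all_order all_algebra all_field.
From mathcomp Require Import boolp classical_sets reals constructive_ereal ereal.

Set Implicit Arguments.
Unset Strict Implicit.
Unset Printing Implicit Defensive.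

Import Order.TTheory GRing.Theory Num.Theory.
Import VectorInternalTheory.

Local Open Scope ring_scope.
Local Open Scope lfun_scope.

(** [tensor U V] is the space of coordinate matrices with respect to the
    bases [e_i (x) e_j], where [e_i = r2v (delta_mx 0 i)] is the coordinate
    basis of a [vectType]. [tlift] is the universal property, see
    [tlift_tens] and [tensor_ext] below. *)

Section Tensor.
Variable K : fieldType.
Implicit Types U V W : vectType K.

Definition tensor U V : vectType K := 'M[K]_(dim U, dim V).

Definition tens U V (u : U) (v : V) : tensor U V := (v2r u)^T *m v2r v.

Definition ebasis U (i : 'I_(dim U)) : U := r2v (delta_mx 0 i).

Definition tlift_fun U V W (b : U -> V -> W) (t : tensor U V) : W :=
  \sum_i \sum_j (t : 'M_(_, _)) i j *: b (ebasis i) (ebasis j).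

Fact tlift_fun_linear U V W (b : U -> V -> W) : linear (tlift_fun b).
Proof.
move=> k s t; rewrite /tlift_fun scaler_sumr -big_split /=.
apply: eq_bigr => i _; rewrite scaler_sumr -big_split /=.
by apply: eq_bigr => j _; rewrite !mxE scalerDl scalerA.
Qed.
HB.instance Definition _ U V W (b : U -> V -> W) :=
  GRing.isLinear.Build K (tensor U V) W _ (tlift_fun b) (tlift_fun_linear b).

Definition tlift U V W (b : U -> V -> W) : 'Hom(tensor U V, W) :=
  linfun (tlift_fun b).

Definition bilin U V W (b : U -> V -> W) : Prop :=
  (forall u, linear (b u)) /\ (forall v, linear (b^~ v)).

End Tensor.

Notation "u ⊗ v" := (tens u v) (at level 40, left associativity).

Section TensorTheory.
Variable K : fieldType.
Implicit Types U V W : vectType K.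

Lemma ebasis_sum U (u : U) : u = \sum_i v2r u 0 i *: ebasis i.
Proof.
apply: (can_inj v2rK); rewrite linear_sum [LHS]row_sum_delta /=.
by apply: eq_bigr => i _; rewrite linearZ /= /ebasis r2vK.
Qed.

Lemma tens_bilin U V : bilin (@tens K U V).
Proof.
split=> [u k v v'|v k u u']; rewrite /tens linearP.
  by rewrite mulmxDr -scalemxAr.
by rewrite linearP /= mulmxDl -scalemxAl.
Qed.

Lemma bilin_sum U V W (b : U -> V -> W) (I J : finType)
    (k : I -> K) (l : J -> K) (u : I -> U) (v : J -> V) : bilin b ->
  b (\sum_i k i *: u i) (\sum_j l j *: v j)
    = \sum_i \sum_j (k i * l j) *: b (u i) (v j).
Proof.
move=> [br bl].
pose bl' y : {linear U -> W} := HB.pack (b^~ y) (GRing.isLinear.Build _ _ _ _ _ (bl y)).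
pose br' x : {linear V -> W} := HB.pack (b x) (GRing.isLinear.Build _ _ _ _ _ (br x)).
rewrite -[LHS]/(bl' _ _) linear_sum; apply: eq_bigr => i _.
rewrite linearZ /= -[b _ _]/(br' _ _) linear_sum scaler_sumr.
by apply: eq_bigr => j _; rewrite linearZ scalerA.
Qed.

Lemma tlift_tens U V W (b : U -> V -> W) : bilin b ->
  forall u v, tlift b (u ⊗ v) = b u v.
Proof.
move=> bb u v; rewrite lfunE /= /tlift_fun {2}[u]ebasis_sum {2}[v]ebasis_sum.
rewrite (bilin_sum _ _ _ _ bb); apply: eq_bigr => i _; apply: eq_bigr => j _.
by rewrite !mxE big_ord1 !mxE.
Qed.

Lemma tensor_sum U V (t : tensor U V) :
  t = \sum_i \sum_j (t : 'M_(_, _)) i j *: (ebasis i ⊗ ebasis j).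
Proof.
rewrite [LHS]matrix_sum_delta; apply: eq_bigr => i _; apply: eq_bigr => j _.
by rewrite /tens /ebasis !r2vK trmx_delta mul_delta_mx.
Qed.

Lemma tensor_ext U V W (f g : 'Hom(tensor U V, W)) :
  (forall u v, f (u ⊗ v) = g (u ⊗ v)) -> f = g.
Proof.
move=> fg; apply/lfunP => t; rewrite [t]tensor_sum !linear_sum /=.
apply: eq_bigr => i _; rewrite !linear_sum /=.
by apply: eq_bigr => j _; rewrite !linearZ /= fg.
Qed.

Definition tmap U U' V V' (f : 'Hom(U, U')) (g : 'Hom(V, V')) :
    'Hom(tensor U V, tensor U' V') :=
  tlift (fun u v => f u ⊗ g v).

Definition tassoc U V W :
    'Hom(tensor (tensor U V) W, tensor U (tensor V W)) :=
  tlift (fun t w => tlift (fun u v => u ⊗ (v ⊗ w)) t).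

End TensorTheory.

Section Hopf.
Variables (K : fieldType) (A : falgType K).

Definition tmul (s t : tensor A A) : tensor A A :=
  tlift (fun a b => tlift (fun c d : A => (a * c) ⊗ (b * d)) t) s.

Record hopf_structure := HopfStructure {
  comul : 'Hom(A, tensor A A);
  counit : 'Hom(A, K^o);
  antipode : 'End(A);
  comulA : forall a,
    tassoc A A A (tmap comul \1 (comul a)) = tmap \1 comul (comul a);
  counitl : forall a, tlift (fun x y : A => counit x *: y) (comul a) = a;
  counitr : forall a, tlift (fun x y : A => counit y *: x) (comul a) = a;
  comul1 : comul 1 = 1 ⊗ 1;
  comulM : forall a b, comul (a * b) = tmul (comul a) (comul b);
  counit1 : counit 1 = 1;
  counitM : forall a b, counit (a * b) = counit a * counit b;
  antipodel : forall a,
    tlift (fun x y : A => antipode x * y) (comul a) = (counit a)%:A;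
  antipoder : forall a,
    tlift (fun x y : A => x * antipode y) (comul a) = (counit a)%:A
}.

End Hopf.

Section Ideals.
Variables (K : fieldType) (A : falgType K).
Implicit Types I J : {vspace A}.

Definition right_ideal I : Prop := (I * {:A} <= I)%VS.

Definition maximal_right_ideal I : Prop :=
  [/\ right_ideal I, I <> {:A}%VS &
      forall J, right_ideal J -> (I <= J)%VS -> J = I \/ J = {:A}%VS].

Definition minimal_right_ideal I : Prop :=
  [/\ right_ideal I, I <> 0%VS &
      forall J, right_ideal J -> (J <= I)%VS -> J = 0%VS \/ J = I].

Definition local_algebra : Prop := exists! I, maximal_right_ideal I.

(* the regular right module is a direct sum of simple submodules *)
Definition semisimple_algebra : Prop :=
  exists (n : nat) (S : 'I_n -> {vspace A}),
    [/\ forall i, minimal_right_ideal (S i),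
        directv (\sum_i S i) & (\sum_i S i)%VS = {:A}%VS].

End Ideals.

Record rmodule (K : fieldType) (A : falgType K) := RModule {
  rmod_sort :> vectType K;
  ract : rmod_sort -> A -> rmod_sort;
  ract_bilin : bilin ract;
  ract1 : forall v, ract v 1 = v;
  ractM : forall v a b, ract v (a * b) = ract (ract v a) b
}.

Notation "v ⋅ a" := (ract v a) (at level 40, left associativity).

Section Modules.
Variables (K : fieldType) (A : falgType K).
Implicit Types M N X Y : rmodule A.

Fact ract_linear M a : linear (fun v : M => v ⋅ a).
Proof. exact: (ract_bilin M).2. Qed.
Fact ractr_linear M v : linear (@ract K A M v).
Proof. exact: (ract_bilin M).1. Qed.

Definition ract_by M (a : A) (v : M) : M := v ⋅ a.
HB.instance Definition _ M a :=
  GRing.isLinear.Build K M M _ (@ract_by M a) (@ract_linear M a).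
HB.instance Definition _ M v :=
  GRing.isLinear.Build K A M _ (@ract K A M v) (@ractr_linear M v).

Lemma ract0 M a : (0 : M) ⋅ a = 0. Proof. exact: linear0 (ract_by a). Qed.

Definition hom_defect M N (a : A) (f : 'Hom(M, N)) : 'Hom(M, N) :=
  (f \o linfun (ract_by (M := M) a)) - (linfun (ract_by (M := N) a) \o f).

Fact hom_defect_linear M N a : linear (@hom_defect M N a).
Proof.
move=> k f g; rewrite /hom_defect comp_lfunDl comp_lfunDr.
by rewrite -comp_lfunZl -comp_lfunZr opprD addrACA scalerBr.
Qed.
HB.instance Definition _ M N a :=
  GRing.isLinear.Build K _ _ _ (@hom_defect M N a) (@hom_defect_linear M N a).

(* A-linearity only has to be tested on a basis of A, see [homAP] *)
Definition homA M N : {vspace 'Hom(M, N)} :=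
  (\bigcap_(i < \dim {:A})
     lker (linfun (@hom_defect M N (vbasis {:A})`_i)))%VS.

Lemma homAP M N (f : 'Hom(M, N)) :
  reflect (forall v a, f (v ⋅ a) = f v ⋅ a) (f \in homA M N).
Proof.
have defE a v : hom_defect a f v = f (v ⋅ a) - f v ⋅ a.
  by rewrite /hom_defect add_lfunE opp_lfunE !comp_lfunE !lfunE.
apply: (iffP idP) => [fA v a|fA]; last first.
  rewrite memvE; apply/subv_bigcapP => i _; rewrite -memvE memv_ker lfunE /=.
  by apply/eqP/lfunP => v; rewrite defE fA subrr zero_lfunE.
rewrite (coord_vbasis (memvf a)) !linear_sum; apply: eq_bigr => i _.
rewrite !linearZ /=; congr (_ *: _); apply/eqP; rewrite -subr_eq0 -defE.
move: fA; rewrite memvE => /subv_bigcapP/(_ i isT).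
by rewrite -memvE memv_ker lfunE /= => /eqP->; rewrite zero_lfunE.
Qed.

(* lifting property in the category of finite dimensional right modules *)
Definition projective M : Prop :=
  forall X Y (g : 'Hom(X, Y)) (f : 'Hom(M, Y)),
    g \in homA X Y -> limg g = fullv -> f \in homA M Y ->
  exists2 h : 'Hom(M, X), h \in homA M X & (g \o h)%VF = f.

Section Submodule.
Variables (M : rmodule A) (U : {vspace M}).
Hypothesis U_stable : forall v a, v \in U -> v ⋅ a \in U.

Definition sub_ract (u : subvs_of U) (a : A) : subvs_of U :=
  vsproj U (vsval u ⋅ a).

Fact vsval_sub_ract u a : vsval (sub_ract u a) = vsval u ⋅ a.
Proof. by rewrite vsprojK // U_stable // subvsP. Qed.

Fact sub_ract_bilin : bilin sub_ract.
Proof.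
split=> [u|a] k x y; apply: subvs_inj; rewrite [RHS]linearP /= !vsval_sub_ract.
  exact: ractr_linear.
by rewrite linearP; apply: ract_linear.
Qed.

Fact sub_ract1 u : sub_ract u 1 = u.
Proof. by apply: subvs_inj; rewrite vsval_sub_ract ract1. Qed.

Fact sub_ractM u a b : sub_ract u (a * b) = sub_ract (sub_ract u a) b.
Proof. by apply: subvs_inj; rewrite !vsval_sub_ract ractM. Qed.

Definition submodule : rmodule A :=
  RModule sub_ract_bilin sub_ract1 sub_ractM.

End Submodule.

Fact lker_stable M N (f : 'Hom(M, N)) : f \in homA M N ->
  forall v a, v \in lker f -> v ⋅ a \in lker f.
Proof.
by move=> /homAP fA v a; rewrite !memv_ker fA => /eqP->;
  rewrite ract0.
Qed.

Definition kernel M N (f : 'Hom(M, N)) (fA : f \in homA M N) : rmodule A :=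
  submodule (lker_stable fA).

Section Free.
Variable V : vectType K.

Definition free_ract (t : tensor V A) (b : A) : tensor V A :=
  tlift (fun v (a : A) => v ⊗ (a * b)) t.

Fact free_bilin0 b : bilin (fun (v : V) (a : A) => v ⊗ (a * b)).
Proof.
have [tr tl] := @tens_bilin K V A.
by split=> [v k a a'|a]; [rewrite mulrDl -scalerAl tr|exact: tl].
Qed.

Fact free_ract_tens v a b : free_ract (v ⊗ a) b = v ⊗ (a * b).
Proof. exact: (tlift_tens (free_bilin0 b)). Qed.

Fact free_ract_bilin : bilin free_ract.
Proof.
split=> [t k a b|b k s t]; last by rewrite /free_ract linearP.
rewrite /free_ract -scale_lfunE -add_lfunE; move: t; apply/lfunP/tensor_ext.
move=> v c; rewrite add_lfunE scale_lfunE -!/(free_ract _ _) !free_ract_tens.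
by rewrite mulrDr -scalerAr (tens_bilin V A).1.
Qed.

Fact free_ract1 t : free_ract t 1 = t.
Proof.
rewrite /free_ract -[RHS]id_lfunE; move: t; apply/lfunP/tensor_ext => v a.
by rewrite -/(free_ract _ _) free_ract_tens mulr1 id_lfunE.
Qed.

Fact free_ractM t a b : free_ract t (a * b) = free_ract (free_ract t a) b.
Proof.
rewrite /free_ract -comp_lfunE; move: t; apply/lfunP/tensor_ext => v c.
by rewrite comp_lfunE -!/(free_ract _ _) !free_ract_tens mulrA.
Qed.

Definition free_module : rmodule A :=
  RModule free_ract_bilin free_ract1 free_ractM.

Lemma free_projective : projective free_module.
Proof.
move=> X Y g f /homAP gA gS /homAP fA.
pose s v : X := (g^-1)%VF (f (v ⊗ 1)).
have hb : bilin (fun v a => s v ⋅ a).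
  split=> [v|a k u v]; first exact: ractr_linear.
  by rewrite /s (tens_bilin V A).2 !linearP; apply: ract_linear.
have hE v a : tlift (fun v a => s v ⋅ a) (v ⊗ a) = s v ⋅ a.
  exact: tlift_tens hb v a.
exists (tlift (fun v a => s v ⋅ a)); last first.
  apply: tensor_ext => v a; rewrite comp_lfunE hE gA /s limg_lfunVK ?gS ?memvf //.
  by rewrite -fA /= free_ract_tens mul1r.
apply/homAP => t b /=; rewrite /free_ract -comp_lfunE.
rewrite -[RHS](lfunE (ract_by (M := X) b)) -comp_lfunE; move: t.
apply/lfunP/tensor_ext => v a; rewrite !comp_lfunE.
rewrite -/(free_ract _ _) free_ract_tens !hE lfunE /= /ract_by.
by rewrite ractM.
Qed.

End Free.

Section Cover.
Variable M : rmodule A.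

Definition cover : 'Hom(free_module M, M) := tlift (@ract K A M).

Fact cover_tens (v : M) a : cover (v ⊗ a) = v ⋅ a.
Proof. exact: (tlift_tens (ract_bilin M)). Qed.

Fact cover_homA : cover \in homA (free_module M) M.
Proof.
apply/homAP => t b /=; rewrite /free_ract -comp_lfunE.
rewrite -[RHS](lfunE (ract_by (M := M) b)) -comp_lfunE; move: t.
apply/lfunP/tensor_ext => v a; rewrite !comp_lfunE.
by rewrite -/(free_ract _ _) free_ract_tens !cover_tens lfunE /= /ract_by ractM.
Qed.

Fact cover_surj : limg cover = fullv.
Proof.
apply/eqP; rewrite eqEsubv subvf; apply/subvP => v _.
by rewrite -[v]ract1 -cover_tens memv_img ?memvf.
Qed.

Definition syzygy : rmodule A := kernel cover_homA.

Definition syzygy_incl : 'Hom(syzygy, free_module M) :=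
  linfun (vsval : subvs_of (lker cover) -> free_module M).

Fact syzygy_incl_homA : syzygy_incl \in homA syzygy (free_module M).
Proof.
apply/homAP => v a; rewrite !lfunE /=.
exact: (vsval_sub_ract (lker_stable cover_homA)).
Qed.

Fact syzygy_incl_img : limg syzygy_incl = lker cover.
Proof.
apply/vspaceP => v; apply/memv_imgP/idP => [[u _ ->]|vK].
  by rewrite lfunE subvsP.
by exists (vsproj (lker cover) v); rewrite ?memvf // lfunE /= vsprojK.
Qed.

Fact syzygy_incl_inj : lker syzygy_incl = 0%VS.
Proof.
by apply/eqP/lker0P => u v; rewrite !lfunE; apply: subvs_inj.
Qed.

End Cover.

Record resolution M := Resolution {
  res_mod :> nat -> rmodule A;
  res_d : forall n, 'Hom(res_mod n.+1, res_mod n);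
  res_aug : 'Hom(res_mod 0, M);
  res_proj : forall n, projective (res_mod n);
  res_d_homA : forall n, res_d n \in homA (res_mod n.+1) (res_mod n);
  res_aug_homA : res_aug \in homA (res_mod 0) M;
  res_aug_surj : limg res_aug = fullv;
  res_exact0 : limg (res_d 0) = lker res_aug;
  res_exact : forall n, limg (res_d n.+1) = lker (res_d n)
}.

Definition free_res_mod M n : rmodule A := free_module (iter n syzygy M).

Definition free_res_d M n : 'Hom(free_res_mod M n.+1, free_res_mod M n) :=
  (syzygy_incl (iter n syzygy M) \o cover (iter n.+1 syzygy M))%VF.

Fact free_res_d_homA M n :
  free_res_d M n \in homA (free_res_mod M n.+1) (free_res_mod M n).
Proof.
have /homAP cA := cover_homA (iter n.+1 syzygy M).
have /homAP iA := syzygy_incl_homA (iter n syzygy M).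
by apply/homAP => v a; rewrite /free_res_d !comp_lfunE cA iA.
Qed.

Fact free_res_d_img M n : limg (free_res_d M n) = lker (cover (iter n syzygy M)).
Proof. by rewrite /free_res_d limg_comp cover_surj syzygy_incl_img. Qed.

Fact free_res_d_ker M n :
  lker (free_res_d M n) = lker (cover (iter n.+1 syzygy M)).
Proof.
apply/vspaceP => v; rewrite !memv_ker /free_res_d comp_lfunE.
by rewrite -[LHS]memv_ker syzygy_incl_inj memv0.
Qed.

Definition free_resolution M : resolution M :=
  @Resolution M (free_res_mod M) (free_res_d M) (cover M)
    (fun n => @free_projective _) (free_res_d_homA M) (cover_homA M)
    (cover_surj M) (free_res_d_img M 0)
    (fun n => etrans (free_res_d_img M n.+1) (esym (free_res_d_ker M n))).

Section Ext.
Variables (M : rmodule A) (P : resolution M) (N : rmodule A).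

Definition precomp n (f : 'Hom(P n, N)) : 'Hom(P n.+1, N) := (f \o res_d P n)%VF.

Fact precomp_linear n : linear (@precomp n).
Proof. by move=> k f g; rewrite /precomp comp_lfunDl -comp_lfunZl. Qed.
HB.instance Definition _ n :=
  GRing.isLinear.Build K 'Hom(P n, N) 'Hom(P n.+1, N) _ (@precomp n)
    (@precomp_linear n).

Definition cocycles n : {vspace 'Hom(P n, N)} :=
  (homA (P n) N :&: lker (linfun (@precomp n)))%VS.

Definition coboundaries n : {vspace 'Hom(P n, N)} :=
  match n with
  | 0 => 0%VS
  | m.+1 => (linfun (@precomp m) @: homA (P m) N)%VS
  end.

(* [U :\: V] is a complement of [U :&: V] in [U], so this is a copy of the
   quotient of the cocycles by the coboundaries *)
Definition cohomology n : {vspace 'Hom(P n, N)} :=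
  (cocycles n :\: coboundaries n)%VS.

Lemma coboundaries_sub n : (coboundaries n <= cocycles n)%VS.
Proof.
case: n => [|n] /=; first exact: sub0v.
apply/subvP => _ /memv_imgP[f /homAP fA ->]; rewrite lfunE /= memv_cap.
have /homAP dA := res_d_homA P n.
apply/andP; split.
  by apply/homAP => v a; rewrite /precomp !comp_lfunE dA fA.
rewrite memv_ker lfunE /= /precomp -comp_lfunA.
suff ->: (res_d P n \o res_d P n.+1)%VF = 0 by rewrite comp_lfun0r.
apply/lfunP => v; rewrite comp_lfunE zero_lfunE; apply/eqP.
by rewrite -memv_ker -res_exact memv_img ?memvf.
Qed.

End Ext.

(* [free_resolution M] has the terms P_n = Omega^n(M) (x) A *)
Definition Ext n M N := cohomology (free_resolution M) N n.

End Modules.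

Section Delta.
Variables (R : realType) (K : fieldType) (A : falgType K).
Local Open Scope classical_set_scope.

(* [R] only serves to provide the ordered set [\bar R] in which the suprema
   and infima are taken; note that [ereal_inf set0 = +oo] *)
Definition phi (M : rmodule A) : \bar R :=
  ereal_inf [set (r%:R)%:E | r in [set r : nat |
    (1 <= r)%N /\ Ext r M M <> 0%VS]].

(* this formula for Delta_A is the one valid for selfinjective algebras, such as
   finite dimensional Hopf algebras *)
Definition Delta : \bar R :=
  ereal_sup [set x | exists M : rmodule A, ~ projective M /\ x = phi M].

End Delta.

(* Main.v *)
From HB Require Import structures.
Require Import Defs.
From mathcomp Require Import all_boot all_order all_algebra all_field.
From mathcomp Require Import boolp classical_sets reals constructive_ereal ereal.

(** A finite dimensional module M over a local Hopf algebra A is projective as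
    soon as Ext^1(M, M) = 0. Conceptually, Ext^1(M, M) is Ext^1(K, End_K(M)),
    and K is the only simple module, so its vanishing makes End_K(M) injective;
    the inclusion of the scalars K into End_K(M) then extends along the
    inclusion of K into A given by an integral, which exhibits M as a summand of
    a free module.

    The proof carries this out with maps out of M ⊗ A instead of End_K(M). The
    kernel of the counit is the unique maximal right ideal, so every proper
    right ideal U admits x outside U with x j in U for all j in that kernel
    ([exists_socle]); for U = 0 this gives an integral l ([exists_integral]).
    Vanishing of Ext^1(M, M) means that every derivation from A to End_K(M) is
    inner ([Ext1_eq0_inner]), and this is exactly what is needed to extend an
    A-linear map M ⊗ U -> M, for the diagonal action, to M ⊗ (U + K x)
    ([equivariant_step]). Starting with v ⊗ l ↦ v on M ⊗ K l one reaches an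
    A-linear map M ⊗ A -> M that splits v ↦ v ⊗ l. Since M ⊗ A with the diagonal
    action is free, by means of the antipode ([to_diag_free_ract], [to_diagK]),
    M is projective ([Ext1_eq0_projective]).

    Hence phi_M = 1 for every non-projective M. As A is not semisimple, the
    trivial module is non-projective ([trivial_not_projective]), so the
    supremum defining Delta_A is over a nonempty set and equals 1. *)

Set Implicit Arguments.
Unset Strict Implicit.
Unset Printing Implicit Defensive.

Import Order.TTheory GRing.Theory.
Import VectorInternalTheory.

(** * Tensors, actions and Sweedler sums *)

Section Sweedler.
Local Open Scope ring_scope.
Local Open Scope lfun_scope.
Variable K : fieldType.
Implicit Types U V W : vectType K.

Lemma lfun_of_linear U V (f : U -> V) : linear f ->
  exists L : 'Hom(U, V), forall u, L u = f u.
Proof.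
move=> fl; pose f' : {linear U -> V} :=
  HB.pack f (GRing.isLinear.Build _ _ _ _ _ fl).
by exists (linfun f') => u; rewrite lfunE.
Qed.

(** The four rules below let [tlift] be manipulated like the formal sum it is,
    including for integrands that are not bilinear. *)
Lemma lfun_tlift U V W W' (L : 'Hom(W, W')) (b : U -> V -> W) t :
  L (tlift b t) = tlift (fun u v => L (b u v)) t.
Proof.
rewrite !lfunE /= /tlift_fun linear_sum; apply: eq_bigr => i _.
by rewrite linear_sum; apply: eq_bigr => j _; rewrite linearZ.
Qed.

Lemma tliftD U V W (b c : U -> V -> W) t :
  tlift (fun u v => b u v + c u v) t = tlift b t + tlift c t.
Proof.
rewrite !lfunE /= /tlift_fun -big_split /=; apply: eq_bigr => i _.
by rewrite -big_split; apply: eq_bigr => j _; rewrite scalerDr.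
Qed.

Lemma tliftZ U V W k (b : U -> V -> W) t :
  tlift (fun u v => k *: b u v) t = k *: tlift b t.
Proof.
rewrite !lfunE /= /tlift_fun scaler_sumr; apply: eq_bigr => i _.
rewrite scaler_sumr; apply: eq_bigr => j _.
by rewrite !scalerA mulrC.
Qed.

Lemma eq_tlift U V W (b c : U -> V -> W) t :
  (forall u v, b u v = c u v) -> tlift b t = tlift c t.
Proof. by move=> bc; congr (tlift _ t); apply/funext => u; apply/funext. Qed.

(** [v ↦ v ⊗ w] under a name, so that it can carry a linear structure. *)
Definition tens_by (V W : vectType K) (w : W) (v : V) : tensor V W := v ⊗ w.
HB.instance Definition _ (V W : vectType K) (w : W) :=
  GRing.isLinear.Build K V (tensor V W) _ (tens_by w) ((tens_bilin V W).2 w).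

Lemma tensDl (V W : vectType K) (u v : V) (w : W) : (u + v) ⊗ w = u ⊗ w + v ⊗ w.
Proof. exact: linearD (tens_by w) u v. Qed.

Lemma tensZl (V W : vectType K) k (v : V) (w : W) : (k *: v) ⊗ w = k *: (v ⊗ w).
Proof. exact: linearZ_LR (tens_by w) k v. Qed.

Lemma tensPr (V W : vectType K) (v : V) k (w w' : W) :
  v ⊗ (k *: w + w') = k *: (v ⊗ w) + v ⊗ w'.
Proof. exact: (tens_bilin V W).1. Qed.

Lemma tensZr (V W : vectType K) (v : V) k (w : W) : v ⊗ (k *: w) = k *: (v ⊗ w).
Proof.
have t0 : v ⊗ (0 : W) = 0.
  by have := tensPr v (-1) (0 : W) 0; rewrite !scaleN1r oppr0 addr0 addNr.
by rewrite -[k *: w]addr0 tensPr t0 addr0.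
Qed.

Variables (A : falgType K) (H : hopf_structure A).

Lemma ractDl (M : rmodule A) (u v : M) (a : A) : (u + v) ⋅ a = u ⋅ a + v ⋅ a.
Proof. exact: linearD (ract_by a) u v. Qed.

Lemma ractZl (M : rmodule A) k (v : M) (a : A) : (k *: v) ⋅ a = k *: (v ⋅ a).
Proof. exact: linearZ_LR (ract_by a) k v. Qed.

Lemma ractDr (M : rmodule A) (v : M) (a b : A) : v ⋅ (a + b) = v ⋅ a + v ⋅ b.
Proof. exact: linearD (ract v) a b. Qed.

Lemma ractZr (M : rmodule A) k (v : M) (a : A) : v ⋅ (k *: a) = k *: (v ⋅ a).
Proof. exact: linearZ_LR (ract v) k a. Qed.

(** [sweedler F a] is the sum of the [F a1 a2] in Sweedler's notation. *)
Local Notation sweedler F a := (tlift F (comul H a)).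

Lemma sweedler_linear W (F : A -> A -> W) : linear (fun a => sweedler F a).
Proof. by move=> k a b; rewrite !linearP. Qed.

Lemma sweedlerM W (F : A -> A -> W) a b : bilin F ->
  sweedler F (a * b) =
  sweedler (fun a1 a2 => sweedler (fun b1 b2 => F (a1 * b1) (a2 * b2)) b) a.
Proof.
move=> bF; rewrite comulM /tmul lfun_tlift; apply: eq_tlift => a1 a2.
by rewrite lfun_tlift; apply: eq_tlift => b1 b2; rewrite tlift_tens.
Qed.

Lemma sweedler_counitl W (G : 'Hom(A, W)) a :
  sweedler (fun a1 a2 => counit H a1 *: G a2) a = G a.
Proof.
rewrite -[in RHS](counitl H a) lfun_tlift.
by apply: eq_tlift => x y; rewrite linearZ.
Qed.

Lemma sweedler_counitr W (G : 'Hom(A, W)) a :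
  sweedler (fun a1 a2 => counit H a2 *: G a1) a = G a.
Proof.
rewrite -[in RHS](counitr H a) lfun_tlift.
by apply: eq_tlift => x y; rewrite linearZ.
Qed.

Lemma sweedler_antipodel W (G : 'Hom(A, W)) a :
  sweedler (fun a1 a2 => G (antipode H a1 * a2)) a = counit H a *: G 1.
Proof. by rewrite -lfun_tlift antipodel linearZ. Qed.

(** Coassociativity, tested against an arbitrary trilinear map [F] by composing
    both sides of [comulA] with the linear map that [F] induces on
    A ⊗ (A ⊗ A). *)
Lemma sweedlerA W (F : A -> A -> A -> W) :
  (forall x y, linear (F x y)) -> (forall x z, linear (F x ^~ z)) ->
  (forall y z, linear (fun x => F x y z)) -> forall a,
  sweedler (fun x a3 => sweedler (fun a1 a2 => F a1 a2 a3) x) a =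
  sweedler (fun a1 y => sweedler (fun a2 a3 => F a1 a2 a3) y) a.
Proof.
move=> F3 F2 F1 a.
have bF x : bilin (F x) by split.
pose b x t := tlift (F x) t.
have bb : bilin b.
  split=> [x k s t|t k x y]; rewrite /b ?linearP //.
  by rewrite -tliftZ -tliftD; apply: eq_tlift => u v; rewrite F1.
have [tr tl] := tens_bilin A A; have [tr' tl'] := tens_bilin A (tensor A A).
have bassoc (w : A) : bilin (fun u v : A => u ⊗ (v ⊗ w)).
  by split=> [u k v v'|v k u u']; [rewrite /= tl tr' | rewrite /= tl'].
have bt : bilin (fun x y : A => tens (comul H x) y).
  have [sr sl] := tens_bilin (tensor A A) A.
  by split=> [x k y y'|y k x x']; [rewrite /= sr | rewrite /= linearP sl].
have bt' : bilin (fun x y : A => tens x (comul H y)).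
  by split=> [x k y y'|y k x x']; [rewrite /= linearP tr' | rewrite /= tl'].
have bt2 : bilin (fun (s : tensor A A) (w : A) =>
    tlift (fun u v : A => u ⊗ (v ⊗ w)) s).
  split=> [s k w w'|w k s s']; last by rewrite linearP.
  rewrite -tliftZ -tliftD; apply: eq_tlift => u v.
  by rewrite tr tr'.
have := congr1 (tlift b) (comulA H a).
rewrite /tassoc /tmap !lfun_tlift => E.
etransitivity; last (etransitivity; first exact: E).
  apply: eq_tlift => x y; rewrite id_lfunE -lfun_tlift tlift_tens // lfun_tlift.
  by apply: eq_tlift => u v; rewrite tlift_tens // /b tlift_tens.
by apply: eq_tlift => x y; rewrite tlift_tens // id_lfunE.
Qed.

End Sweedler.

(** * The augmentation ideal of a local Hopf algebra *)

Section RightIdeals.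
Local Open Scope ring_scope.
Local Open Scope lfun_scope.
Variables (K : fieldType) (A : falgType K).
Implicit Types (I J U V : {vspace A}).

Lemma right_idealP I :
  right_ideal I <-> forall x a, x \in I -> x * a \in I.
Proof.
split=> [/prodvP rI x a xI|rI]; first exact: rI xI (memvf a).
by apply/prodvP => x a xI _; apply: rI.
Qed.

Lemma right_ideal_full I : right_ideal I -> 1 \in I -> I = fullv.
Proof.
move=> /right_idealP rI I1; apply/eqP; rewrite eqEsubv subvf.
by apply/subvP => a _; rewrite -[a]mul1r rI.
Qed.

Lemma right_ideal_principal x : right_ideal (amull x @: {:A})%VS.
Proof.
apply/right_idealP => y a /memv_imgP[b _ ->]; apply/memv_imgP.
by exists (b * a); rewrite ?memvf // !lfunE /= mulrA.
Qed.

Lemma principal_id x : x \in (amull x @: {:A})%VS.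
Proof. by apply/memv_imgP; exists 1; rewrite ?memvf // lfunE /= mulr1. Qed.

Lemma proper_sub_maximal I : right_ideal I -> I <> fullv ->
  exists2 J, maximal_right_ideal J & (I <= J)%VS.
Proof.
have [n] := ubnP (\dim {:A} - \dim I); elim: n I => // n IHn I leIn rI pI.
have [mI|nmI] := pselect (maximal_right_ideal I); first by exists I.
have [J [rJ sIJ nJI pJ]] :
    exists J, [/\ right_ideal J, (I <= J)%VS, J <> I & J <> fullv].
  apply: contrapT => nJ; apply: nmI; split=> // J rJ sIJ.
  have [->|nJI] := pselect (J = I); first by left.
  have [->|pJ] := pselect (J = fullv); first by right.
  by case: nJ; exists J.
have ltIJ : (\dim I < \dim J)%N.
  rewrite ltn_neqAle dimvS // andbT; apply/negP => /eqP eqIJ.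
  by case: nJI; apply/esym; apply/eqP; rewrite eqEdim sIJ eqIJ /=.
have [|J' mJ' sJJ'] := IHn J _ rJ pJ; last first.
  by exists J' => //; apply: subv_trans sJJ'.
have leJ := dimvS (subvf J).
rewrite ltnS in leIn; apply: leq_trans leIn.
by rewrite ltn_sub2l // (leq_trans ltIJ).
Qed.

End RightIdeals.

Section LocalHopf.
Local Open Scope ring_scope.
Local Open Scope lfun_scope.
Variables (K : fieldType) (A : falgType K) (H : hopf_structure A).
Hypothesis A_local : local_algebra A.
Implicit Types (I J U V : {vspace A}).

Lemma mem_aug a : (a \in lker (counit H)) = (counit H a == 0).
Proof. exact: memv_ker. Qed.

(** The counit identifies the quotient by its kernel with the field, so the
    kernel has codimension one. *)
Lemma aug_maximal : maximal_right_ideal (lker (counit H)).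
Proof.
split=> [|aug1|J rJ sJ].
- apply/right_idealP => x a; rewrite !mem_aug counitM => /eqP->.
  by rewrite mul0r.
- by have := memvf (1 : A); rewrite -aug1 mem_aug counit1 oner_eq0.
have [/subvP sJ'|/subvPn[x xJ xn0]] := boolP (J <= lker (counit H))%VS.
  by left; apply/eqP; rewrite eqEsubv sJ andbT; apply/subvP.
rewrite mem_aug in xn0; right; apply: right_ideal_full => //.
rewrite -(subrK ((counit H x)^-1 *: x) 1) memvD ?memvZ //.
apply: (subvP sJ); rewrite mem_aug linearB linearZ /= counit1.
by rewrite -[_ *: _]/(_ * _) mulVf // subrr.
Qed.

(** Every proper right ideal lies in a maximal one, and there is only one. *)
Lemma proper_sub_aug I : right_ideal I -> I <> fullv -> (I <= lker (counit H))%VS.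
Proof.
move=> rI pI; have [J mJ sIJ] := proper_sub_maximal rI pI.
by have [J0 [_ uJ0]] := A_local; rewrite -(uJ0 _ aug_maximal) (uJ0 _ mJ).
Qed.

Lemma counit_neq0_rinv a : counit H a != 0 -> exists b, a * b = 1.
Proof.
move=> na; have [full|pa] := pselect ((amull a @: {:A})%VS = fullv).
  have := memvf (1 : A); rewrite -full => /memv_imgP[b _ ->].
  by exists b; rewrite lfunE.
have /subvP/(_ a (principal_id a)) := proper_sub_aug (right_ideal_principal a) pa.
by rewrite mem_aug (negPf na).
Qed.

(** The only simple module of a local Hopf algebra is the trivial one, so the
    nonzero module A / U contains a copy of it. To find it,
    take a right ideal [V] of least dimension not contained in [U], and [x] in
    [V] outside [U]: if some [x j] were outside [U] as well, it would generate
    [V], so that [x = x j a], which forces [x = 0] as [1 - j a] is right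
    invertible. *)
Lemma exists_socle U : right_ideal U -> U <> fullv ->
  exists2 x, x \notin U & forall j, counit H j = 0 -> x * j \in U.
Proof.
move=> rU pU.
suff key n V : (\dim V < n)%N -> right_ideal V -> ~~ (V <= U)%VS ->
    exists2 x, x \notin U & forall j, counit H j = 0 -> x * j \in U.
  apply: (key _ fullv (ltnSn _)).
    by apply/right_idealP => x a _; apply: memvf.
  by apply/negP => sU; apply: pU; apply/eqP; rewrite eqEsubv subvf.
elim: n V => // n IHn V ltVn rV nVU.
have /subvPn[x xV xU] := nVU.
have [xJ|] := pselect (forall j, counit H j = 0 -> x * j \in U); first by exists x.
move=> /existsNP[j /not_implyP[j0 /negP xjU]].
pose V' := (amull (x * j) @: {:A})%VS.
apply: (IHn V'); last first.
- by apply/negP => /subvP/(_ _ (principal_id _)); apply/negP.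
- exact: right_ideal_principal.
have sV'V : (V' <= V)%VS.
  apply/subvP => _ /memv_imgP[a _ ->]; rewrite lfunE /= -mulrA.
  by apply: (right_idealP V).1.
rewrite ltnS in ltVn; apply: leq_trans ltVn; rewrite ltn_neqAle dimvS // andbT.
apply/negP => /eqP eqd.
have eqV : V' = V by apply/eqP; rewrite eqEdim sV'V eqd /=.
move: xV; rewrite -eqV => /memv_imgP[a _]; rewrite lfunE /= => ex.
have [|b eb] := @counit_neq0_rinv (1 - j * a).
  by rewrite linearB /= counit1 counitM j0 mul0r subr0 oner_eq0.
have x0 : x = 0.
  by rewrite -[x]mulr1 -eb mulrA mulrBr mulr1 mulrA -ex subrr mul0r.
by move: xU; rewrite x0 mem0v.
Qed.

(** The case U = 0: a copy of the trivial module inside the regular one is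
    spanned by a nonzero integral. *)
Lemma exists_integral : exists2 l : A, l != 0 & forall a, l * a = counit H a *: l.
Proof.
have [||l nl lJ] := @exists_socle 0%VS.
- by apply/right_idealP => x a; rewrite !memv0 => /eqP->; rewrite mul0r.
- by move=> e; have := memvf (1 : A); rewrite -e memv0 oner_eq0.
exists l => [|a]; first by rewrite -memv0.
have /lJ : counit H (a - counit H a *: 1) = 0.
  by rewrite linearB linearZ /= counit1 -[_ *: _]/(_ * _) mulr1 subrr.
by rewrite memv0 mulrBr subr_eq0 -scalerAr mulr1 => /eqP.
Qed.

End LocalHopf.

(** * Derivations and the vanishing of Ext^1 *)

Section Derivations.
Local Open Scope ring_scope.
Local Open Scope lfun_scope.
Variables (K : fieldType) (A : falgType K).

Lemma projective_retract (M P : rmodule A) (i : 'Hom(M, P)) (p : 'Hom(P, M)) :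
    projective P -> i \in homA M P -> p \in homA P M -> (p \o i = \1)%VF ->
  projective M.
Proof.
move=> projP /homAP iA /homAP pA pi X Y g f gA gS /homAP fA.
have [|h /homAP hA ghf] := projP X Y g (f \o p)%VF gA gS.
  by apply/homAP => v a; rewrite !comp_lfunE pA fA.
exists (h \o i)%VF; first by apply/homAP => v a; rewrite !comp_lfunE iA hA.
by rewrite comp_lfunA ghf -comp_lfunA pi comp_lfun1r.
Qed.

(** Ext^1(M, N) is the obstruction to extending maps from the first syzygy,
    here the kernel of the augmentation, to the projective module P_0. *)
Lemma cohomology1_eq0_extend (M N : rmodule A) (P : resolution M)
    (D : 'Hom(P 0, N)) :
    cohomology P N 1 = 0%VS ->
    (forall t b, t \in lker (res_aug P) -> D (t ⋅ b) = D t ⋅ b) ->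
  exists2 k, k \in homA (P 0) N & forall t, t \in lker (res_aug P) -> D t = k t.
Proof.
move=> coh0 DA.
have fK : (D \o res_d P 0)%VF \in cocycles P N 1.
  have /homAP dA := res_d_homA P 0.
  rewrite memv_cap; apply/andP; split.
    apply/homAP => w b; rewrite !comp_lfunE dA DA //.
    by rewrite -(res_exact0 P) memv_img ?memvf.
  rewrite memv_ker lfunE /= /precomp -comp_lfunA.
  apply/eqP/lfunP => w; rewrite !comp_lfunE.
  suff /eqP-> : res_d P 0 (res_d P 1 w) == 0 by rewrite linear0 zero_lfunE.
  by rewrite -memv_ker -(res_exact P 0) memv_img ?memvf.
have sub : (cocycles P N 1 <= coboundaries P N 1)%VS.
  by rewrite -diffv_eq0; apply/eqP.
have /memv_imgP[k kA] := subvP sub _ fK.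
rewrite lfunE /= /precomp => /lfunP Dk.
exists k => // t; rewrite -(res_exact0 P) => /memv_imgP[w _ ->].
by have := Dk w; rewrite !comp_lfunE.
Qed.

(** [D] encodes a derivation from A to the bimodule Hom_K(M, N). On M ⊗ A the
    failure of [D] to be A-linear factors through the action map, hence
    vanishes on the syzygy; an A-linear extension [k] of the restriction of [D]
    to the syzygy is determined by [T v = k (v ⊗ 1)], and comparing [D] with [k]
    on [v ⊗ a - (v ⋅ a) ⊗ 1] shows that [D] is inner. *)
Lemma Ext1_eq0_inner (M N : rmodule A) (D : 'Hom(tensor M A, N)) :
    Ext 1 M N = 0%VS ->
    (forall v a b, D (v ⊗ (a * b)) = D (v ⊗ a) ⋅ b + D ((v ⋅ a) ⊗ b)) ->
  exists T : 'Hom(M, N), forall v a, D (v ⊗ a) = T v ⋅ a - T (v ⋅ a).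
Proof.
move=> ext0 DM.
have DcE t b : D (free_ract t b) = D t ⋅ b + D (Defs.cover M t ⊗ b).
  rewrite /free_ract -[_ ⋅ b](lfunE (ract_by (M := N) b)).
  rewrite -[_ ⊗ b](lfunE (tens_by b)) -!comp_lfunE -add_lfunE.
  move: t; apply/lfunP/tensor_ext => v a.
  rewrite add_lfunE !comp_lfunE -/(free_ract _ _) free_ract_tens DM.
  by rewrite [in RHS]cover_tens !lfunE.
have [|k /homAP kA DkE] :=
    @cohomology1_eq0_extend M N (free_resolution M) D ext0.
  move=> t b; rewrite memv_ker => /eqP ct0.
  rewrite [LHS]DcE [Defs.cover M t]ct0.
  by rewrite -/(tens_by b 0) !linear0 addr0.
have D1 v : D (v ⊗ 1) = 0.
  apply: (addrI (D (v ⊗ 1))); rewrite addr0; have := DM v 1 1.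
  by rewrite mulr1 !ract1 => <-.
(* retyping [k] on the tensor product keeps the resolution from unfolding *)
have [k0 k0E] : exists k0 : 'Hom(tensor M A, N), k0 = k by exists k.
rewrite -{}k0E in kA DkE.
pose T : 'Hom(M, N) := (k0 \o linfun (tens_by (1 : A)))%VF.
have TE v a : k0 (v ⊗ a) = T v ⋅ a.
  by rewrite /T comp_lfunE lfunE -kA /= free_ract_tens mul1r.
exists T => v a; rewrite -TE.
have := DkE (v ⊗ a - (v ⋅ a) ⊗ 1).
rewrite memv_ker !linearB /= !cover_tens ract1 subrr eqxx D1 subr0 => /(_ isT)->.
by congr (_ - _); rewrite TE ract1.
Qed.

End Derivations.

(** * The diagonal action on M (x) A is free *)

Section Diagonal.
Local Open Scope ring_scope.
Local Open Scope lfun_scope.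
Variables (K : fieldType) (A : falgType K) (H : hopf_structure A) (M : rmodule A).
Local Notation sweedler F a := (tlift F (comul H a)).

Lemma ract_sweedler_bilin (V W : vectType K) (F : V -> A -> A -> W) :
    (forall a1 a2, linear (fun v => F v a1 a2)) ->
  bilin (fun v a => sweedler (F v) a).
Proof.
move=> Fl; split=> [v|a] k x y /=; first exact: sweedler_linear.
by rewrite -tliftZ -tliftD; apply: eq_tlift => a1 a2; rewrite Fl.
Qed.

(** The tensor product of M with the regular module, with the usual action
    through the comultiplication. *)
Definition diag_act (b : A) : 'End(tensor M A) :=
  tlift (fun v a => sweedler (fun b1 b2 => (v ⋅ b1) ⊗ (a * b2)) b).

Lemma diag_act_tens b v a :
  diag_act b (v ⊗ a) = sweedler (fun b1 b2 => (v ⋅ b1) ⊗ (a * b2)) b.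
Proof.
rewrite /diag_act tlift_tens //; split=> [u k x y|x k u w].
  rewrite -tliftZ -tliftD; apply: eq_tlift => b1 b2.
  by rewrite mulrDl -scalerAl tensPr.
rewrite -tliftZ -tliftD; apply: eq_tlift => b1 b2.
by rewrite ractDl ractZl tensDl tensZl.
Qed.

(** [to_diag] and [of_diag] are inverse isomorphisms between the free module on
    the space M and M ⊗ A with the diagonal action: [to_diag] is the A-linear
    map that fixes each [v ⊗ 1]. *)
Definition to_diag : 'End(tensor M A) :=
  tlift (fun v a => sweedler (fun a1 a2 => (v ⋅ a1) ⊗ a2) a).

Lemma to_diag_tens v a :
  to_diag (v ⊗ a) = sweedler (fun a1 a2 => (v ⋅ a1) ⊗ a2) a.
Proof.
rewrite /to_diag tlift_tens //; apply: ract_sweedler_bilin => a1 a2 k u w.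
by rewrite ractDl ractZl tensDl tensZl.
Qed.

Definition of_diag : 'End(tensor M A) :=
  tlift (fun v a => sweedler (fun a1 a2 => (v ⋅ antipode H a1) ⊗ a2) a).

Lemma of_diag_tens v a :
  of_diag (v ⊗ a) = sweedler (fun a1 a2 => (v ⋅ antipode H a1) ⊗ a2) a.
Proof.
rewrite /of_diag tlift_tens //; apply: ract_sweedler_bilin => a1 a2 k u w.
by rewrite ractDl ractZl tensDl tensZl.
Qed.

Lemma ract_tens_bilin (v : M) (a : A) : bilin (fun b1 b2 : A => (v ⋅ b1) ⊗ (a * b2)).
Proof.
split=> [b1|b2] k x y.
  by rewrite mulrDr -scalerAr tensPr.
by rewrite ractDr ractZr tensDl tensZl.
Qed.

Lemma to_diag_free_ract t b : to_diag (free_ract t b) = diag_act b (to_diag t).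
Proof.
rewrite /free_ract -!comp_lfunE; move: t; apply/lfunP/tensor_ext => v a.
rewrite !comp_lfunE -/(free_ract _ _) free_ract_tens !to_diag_tens sweedlerM.
  rewrite [RHS]lfun_tlift; apply: eq_tlift => a1 a2.
  by rewrite diag_act_tens; apply: eq_tlift => b1 b2; rewrite ractM.
have [br bl] := ract_tens_bilin v 1.
by split=> [b1|b2] k x y /=;
  [have := br b1 k x y | have := bl b2 k x y]; rewrite !mul1r.
Qed.

Lemma of_diagK : cancel of_diag to_diag.
Proof.
move=> t; rewrite -[RHS]id_lfunE -comp_lfunE.
move: t; apply/lfunP/tensor_ext => v a.
rewrite comp_lfunE id_lfunE of_diag_tens lfun_tlift.
pose F a1 a2 a3 := (v ⋅ (antipode H a1 * a2)) ⊗ a3 : tensor M A.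
rewrite (eq_tlift (c := fun a1 y => sweedler (F a1) y)); last first.
  by move=> a1 y; rewrite to_diag_tens; apply: eq_tlift => a2 a3; rewrite /F ractM.
rewrite -(sweedlerA H (F := F)) {}/F /=.
- transitivity (sweedler (fun x a3 => counit H x *: (v ⊗ a3)) a).
    apply: eq_tlift => x a3.
    pose G := (linfun (tens_by a3) \o linfun (@ract K A M v))%VF.
    have GE y : G y = (v ⋅ y) ⊗ a3 by rewrite comp_lfunE !lfunE.
    transitivity (sweedler (fun a1 a2 => G (antipode H a1 * a2)) x).
      by apply: eq_tlift => a1 a2; rewrite GE.
    by rewrite sweedler_antipodel GE ract1.
  have vl : linear (fun b : A => v ⊗ b) by move=> k x y; rewrite tensPr.
  have [G GE] := lfun_of_linear vl.
  rewrite -GE -(sweedler_counitl H G); apply: eq_tlift => x y.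
  by rewrite GE.
- by move=> x y k u w; rewrite tensPr.
- by move=> x y k u w; rewrite mulrDr -scalerAr ractDr ractZr tensDl tensZl.
- move=> x y k u w.
  by rewrite linearP mulrDl -scalerAl ractDr ractZr tensDl tensZl.
Qed.

(** The right inverse [of_diag] is injective, hence bijective since
    M ⊗ A has finite dimension. *)
Lemma to_diagK : cancel to_diag of_diag.
Proof.
have of_diag_inj : lker of_diag == 0%VS.
  by apply/lker0P => s t /(congr1 to_diag); rewrite !of_diagK.
move=> t; rewrite -[t in LHS](lker0_lfunVK of_diag_inj) of_diagK.
exact: lker0_lfunVK.
Qed.

End Diagonal.

(** * Extending equivariant maps *)

Section Extension.
Local Open Scope ring_scope.
Local Open Scope lfun_scope.
Variables (K : fieldType) (A : falgType K) (H : hopf_structure A).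
Hypothesis A_local : local_algebra A.
Variable M : rmodule A.
Local Notation sweedler F a := (tlift F (comul H a)).
Implicit Types (U : {vspace A}) (G : 'Hom(A, 'End(M))).

(** [G] stands for the map [v ⊗ u ↦ G u v] from M ⊗ U to M, and the condition
    says that it is A-linear for the diagonal action. Keeping [G] defined on
    all of A avoids partial functions. *)
Definition equivariant_on U G : Prop := forall v u a, u \in U ->
  sweedler (fun a1 a2 => G (u * a2) (v ⋅ a1)) a = G u v ⋅ a.

Lemma exists_functional U x : x \notin U ->
  exists2 l : 'Hom(A, K^o), l x = 1 & forall u, u \in U -> l u = 0.
Proof.
move=> xU; pose p := (\1 - projv U)%VF.
have px : p x != 0.
  apply: contra xU => /eqP; rewrite /p add_lfunE opp_lfunE id_lfunE => /eqP.
  by rewrite subr_eq0 => /eqP->; apply: memv_proj.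
have [i pxi] : exists i, v2r (p x) 0 i != 0.
  apply/existsP; apply: contraR px => /existsPn px0; apply/eqP.
  apply: (can_inj v2rK); rewrite linear0; apply/rowP => i; rewrite mxE.
  by apply/eqP; have := px0 i; rewrite negbK.
have ll : linear (fun a : A => (v2r (p x) 0 i)^-1 * v2r (p a) 0 i : K^o).
  move=> k a b; rewrite !linearP !mxE mulrDr -[_ *: _]/(_ * _).
  by rewrite mulrCA.
have [l lE] := lfun_of_linear ll.
exists l; first by rewrite lE mulVf.
move=> u uU; have pu : p u = 0.
  by rewrite /p add_lfunE opp_lfunE id_lfunE projv_id // subrr.
by rewrite lE pu linear0 mxE mulr0.
Qed.

(** Extending [G] to [x] means choosing [T = G' x] with
    [T v ⋅ a - T (v ⋅ a)] equal to the sum of the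
    [G (x (a2 - ε(a2))) (v ⋅ a1)]. The elements
    [x (a2 - ε(a2))] lie in [U], where [G] is equivariant; this makes the sum a
    derivation in [a], hence inner when Ext^1(M, M) vanishes. *)
Lemma equivariant_step U G x :
    Ext 1 M M = 0%VS -> right_ideal U -> equivariant_on U G ->
    x \notin U -> (forall j, counit H j = 0 -> x * j \in U) ->
  exists2 G', equivariant_on (U + <[x]>) G' & forall u, u \in U -> G' u = G u.
Proof.
move=> ext0 /right_idealP rU eG xU xJ.
have [r rE] : exists r : 'End(A), forall a, r a = x * (a - counit H a *: 1).
  apply: lfun_of_linear => k a b.
  rewrite linearP scalerDl opprD addrACA -scalerA -scalerBr.
  by rewrite mulrDr -scalerAr.
have rU' a : r a \in U.
  rewrite rE; apply: xJ; rewrite linearB linearZ /= counit1 -[_ *: _]/(_ * _).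
  by rewrite mulr1 subrr.
have xaE a : x * a = r a + counit H a *: x.
  by rewrite rE mulrBr -scalerAr mulr1 subrK.
have rM a b : r (a * b) = r a * b + counit H a *: r b.
  apply: (addIr (counit H (a * b) *: x)); rewrite -xaE mulrA xaE mulrDl.
  by rewrite -scalerAl xaE counitM scalerDr scalerA addrA.
have Fbilin v : bilin (fun a1 a2 => G (r a2) (v ⋅ a1)).
  split=> [a1|a2] k a b; last by rewrite ractDr ractZr linearP.
  by rewrite !linearP add_lfunE scale_lfunE.
pose D : 'Hom(tensor M A, M) :=
  tlift (fun v a => sweedler (fun a1 a2 => G (r a2) (v ⋅ a1)) a).
have DE v a : D (v ⊗ a) = sweedler (fun a1 a2 => G (r a2) (v ⋅ a1)) a.
  rewrite /D tlift_tens //; apply: ract_sweedler_bilin => a1 a2 k u w.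
  by rewrite ractDl ractZl linearP.
(* the two terms of [rM] give the two terms of the derivation rule *)
have [|T TE] := @Ext1_eq0_inner K A M M D ext0.
  move=> v a b; rewrite !DE sweedlerM //.
  rewrite -[_ ⋅ b](lfunE (ract_by (M := M) b)) lfun_tlift -DE.
  pose L := (D \o linfun (tens_by b) \o linfun (@ract K A M v))%VF.
  have LE c : L c = D ((v ⋅ c) ⊗ b) by rewrite !comp_lfunE !lfunE.
  rewrite -LE -(sweedler_counitr H L) -tliftD; apply: eq_tlift => a1 a2.
  rewrite LE DE -tliftZ lfunE /= /ract_by -eG // -tliftD.
  apply: eq_tlift => b1 b2; rewrite -!ractM rM linearD linearZ /=.
  by rewrite add_lfunE scale_lfunE.
have [l lx lU] := exists_functional xU.
(* [l] changes the value at [x] from [G x] to [T] and leaves [U] alone *)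
have [G' G'E] : exists G' : 'Hom(A, 'End(M)),
    forall a, G' a = G a + l a *: (T - G x).
  apply: lfun_of_linear => k a b; rewrite !linearP /= scalerDl -scalerA.
  by rewrite [in RHS]scalerDr addrACA.
have G'U u : u \in U -> G' u = G u by move=> uU; rewrite G'E lU // scale0r addr0.
have G'x : G' x = T by rewrite G'E lx scale1r addrC subrK.
exists G' => // v _ a /memv_addP[u uU [_ /vlineP[k ->] ->]].
rewrite linearD linearZ /= add_lfunE scale_lfunE G'x G'U // ractDl ractZl -eG //.
have -> : T v ⋅ a = sweedler (fun a1 a2 => G' (x * a2) (v ⋅ a1)) a.
  apply: (addIr (- T (v ⋅ a))); rewrite -TE DE.
  pose L := (T \o linfun (@ract K A M v))%VF.
  have LE c : L c = T (v ⋅ c) by rewrite !comp_lfunE !lfunE.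
  rewrite -LE -(sweedler_counitr H L) -scaleN1r -tliftZ -tliftD.
  apply: eq_tlift => a1 a2; rewrite xaE linearD linearZ /= G'x G'U //.
  by rewrite add_lfunE scale_lfunE scaleN1r LE addrK.
rewrite -tliftZ -tliftD; apply: eq_tlift => a1 a2.
by rewrite mulrDl -scalerAl linearD linearZ /= add_lfunE scale_lfunE G'U ?rU.
Qed.

(** An instance of Baer's criterion: a local Hopf algebra has a filtration by
    right ideals with trivial factors from any right ideal up to A. *)
Lemma equivariant_extend U G :
    Ext 1 M M = 0%VS -> right_ideal U -> equivariant_on U G ->
  exists2 G', equivariant_on fullv G' & forall u, u \in U -> G' u = G u.
Proof.
move=> ext0; have [n] := ubnP (\dim {:A} - \dim U).
elim: n U G => // n IHn U G leUn rU eG.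
have [eU|pU] := pselect (U = fullv); first by exists G => //; rewrite -eU.
have [x xU xJ] := exists_socle H A_local rU pU.
have [G1 eG1 G1U] := equivariant_step ext0 rU eG xU xJ.
have sUx : (U <= U + <[x]>)%VS by apply: addvSl.
have rUx : right_ideal (U + <[x]>)%VS.
  apply/right_idealP => _ a /memv_addP[u uU [_ /vlineP[k ->] ->]].
  have -> : (u + k *: x) * a =
      (u * a + k *: (x * (a - counit H a *: 1))) + (k * counit H a) *: x.
    by rewrite mulrDl -scalerAl mulrBr -scalerAr mulr1 scalerBr scalerA -addrA subrK.
  apply: memv_add; last by rewrite memvZ ?memv_line.
  rewrite memvD ?memvZ //; first exact: (right_idealP U).1.
  by apply: xJ; rewrite linearB linearZ /= counit1 -[_ *: _]/(_ * _) mulr1 subrr.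
have ltU : (\dim U < \dim (U + <[x]>))%N.
  rewrite ltn_neqAle dimvS // andbT; apply: contra xU => /eqP eqd.
  have -> : U = (U + <[x]>)%VS by apply/eqP; rewrite eqEdim sUx eqd /=.
  by apply: (subvP (addvSr U <[x]>)); apply: memv_line.
have [|G' eG' G'U] := IHn _ _ _ rUx eG1.
  rewrite ltnS in leUn; apply: leq_trans leUn.
  by rewrite ltn_sub2l // (leq_trans ltU) // dimvS ?subvf.
by exists G' => // u uU; rewrite G'U ?G1U // (subvP sUx).
Qed.

(** Starting from [G l = 1] for an integral [l], extension to A makes the map
    [v ↦ v ⊗ l] from M to the free module M ⊗ A split. *)
Lemma Ext1_eq0_projective : Ext 1 M M = 0%VS -> projective M.
Proof.
move=> ext0; have [l l0 lE] := exists_integral H A_local.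
have [f fl _] : exists2 f : 'Hom(A, K^o), f l = 1 &
    forall u, u \in 0%VS -> f u = 0.
  by apply: exists_functional; rewrite memv0.
have [G0 G0E] : exists G0 : 'Hom(A, 'End(M)), forall a, G0 a = f a *: \1%VF.
  by apply: lfun_of_linear => k a b; rewrite linearP scalerDl -scalerA.
have rl : right_ideal <[l]>%VS.
  apply/right_idealP => _ a /vlineP[k ->]; rewrite -scalerAl lE.
  by rewrite !memvZ ?memv_line.
(* on the trivial module spanned by [l], equivariance is the counit axiom *)
have eG0 : equivariant_on <[l]> G0.
  move=> v _ a /vlineP[k ->].
  pose L := (k *: linfun (@ract K A M v))%VF.
  have LE c : L c = k *: (v ⋅ c) by rewrite scale_lfunE lfunE.
  rewrite linearZ /= G0E fl scale1r scale_lfunE id_lfunE ractZl -LE.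
  rewrite -(sweedler_counitr H L); apply: eq_tlift => a1 a2.
  rewrite LE -scalerAl lE !linearZ /= G0E fl scale1r !scale_lfunE id_lfunE.
  by rewrite !scalerA mulrC.
have [G eG Gl] := equivariant_extend ext0 rl eG0.
pose ev : 'Hom(tensor M A, M) := tlift (fun v a => G a v).
have evE v a : ev (v ⊗ a) = G a v.
  rewrite /ev tlift_tens //; split=> [u k x y|x k u w]; last by rewrite linearP.
  by rewrite linearP add_lfunE scale_lfunE.
have evA b t : ev (diag_act H M b t) = ev t ⋅ b.
  rewrite -[RHS](lfunE (ract_by (M := M) b)) -!comp_lfunE.
  move: t; apply/lfunP/tensor_ext => v a.
  rewrite !comp_lfunE diag_act_tens lfun_tlift lfunE /= /ract_by evE -eG ?memvf //.
  by apply: eq_tlift => b1 b2; rewrite evE.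
pose i : 'Hom(M, free_module A M) := (of_diag H M \o linfun (tens_by l))%VF.
pose p : 'Hom(free_module A M, M) := (ev \o to_diag H M)%VF.
have iE v : i v = of_diag H M (v ⊗ l).
  by rewrite comp_lfunE; congr (_ _); rewrite lfunE.
apply: (@projective_retract _ _ M (free_module A M) i p).
- exact: free_projective.
- apply/homAP => v b; rewrite !iE.
  apply: (can_inj (@to_diagK K A H M)) => /=; rewrite to_diag_free_ract !of_diagK.
  rewrite diag_act_tens.
  pose L := (linfun (tens_by l) \o linfun (@ract K A M v))%VF.
  have LE c : L c = (v ⋅ c) ⊗ l by rewrite !comp_lfunE !lfunE.
  rewrite -LE -(sweedler_counitr H L); apply: eq_tlift => b1 b2.
  by rewrite LE lE tensZr.
- by apply/homAP => t b; rewrite /p !comp_lfunE /= to_diag_free_ract evA.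
apply/lfunP => v; rewrite comp_lfunE iE comp_lfunE of_diagK evE Gl ?memv_line //.
by rewrite G0E fl scale1r.
Qed.

End Extension.

(** * The trivial module *)

Section Trivial.
Local Open Scope ring_scope.
Local Open Scope lfun_scope.
Variables (K : fieldType) (A : falgType K) (H : hopf_structure A).

Fact trivial_ract_bilin : bilin (fun (k : K^o) (a : A) => counit H a *: k).
Proof.
split=> [k c a b|a c k k']; first by rewrite linearP scalerDl -scalerA.
by rewrite scalerDr !scalerA mulrC.
Qed.

Fact trivial_ract1 (k : K^o) : counit H 1 *: k = k.
Proof. by rewrite counit1 scale1r. Qed.

Fact trivial_ractM (k : K^o) a b :
  counit H (a * b) *: k = counit H b *: (counit H a *: k).
Proof. by rewrite counitM scalerA mulrC. Qed.

Definition trivial_module : rmodule A :=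
  RModule trivial_ract_bilin trivial_ract1 trivial_ractM.

Fact regular_ract_bilin : bilin (fun a b : A => a * b).
Proof.
split=> [a k b c|a k b c]; first by rewrite mulrDr -scalerAr.
by rewrite mulrDl -scalerAl.
Qed.

Definition regular_module : rmodule A :=
  RModule regular_ract_bilin (@mulr1 A) (fun a b c : A => mulrA a b c).

Lemma dim1_semisimple : \dim {:A} = 1%N -> semisimple_algebra A.
Proof.
move=> dA; exists 1%N, (fun _ => {:A}%VS); split.
- move=> _; split=> [|A0|J _ _].
  + by apply/right_idealP => x a _; apply: memvf.
  + by move: dA; rewrite A0 dimv0.
  have [J0|J0] := eqVneq J 0%VS; [by left | right].
  by apply/eqP; rewrite eqEdim subvf dA lt0n dimv_eq0.
- by rewrite directvE /= !big_ord1.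
- by rewrite big_ord1.
Qed.

(** If the counit splits, the image [e] of 1 spans a right ideal that is not
    contained in the augmentation ideal. By locality it is all of A, so A is the
    field itself. *)
Lemma trivial_not_projective : local_algebra A -> ~ semisimple_algebra A ->
  ~ projective trivial_module.
Proof.
move=> A_local nss projK; apply: nss; apply: dim1_semisimple.
have [|||h /homAP hA he] := projK regular_module trivial_module (counit H) \1%VF.
- by apply/homAP => v a /=; rewrite counitM mulrC.
- apply/eqP; rewrite eqEsubv subvf; apply/subvP => k _; apply/memv_imgP.
  exists (k *: 1); rewrite ?memvf // linearZ /= counit1.
  by rewrite -[_ *: _]/(_ * _) mulr1.
- by apply/homAP => v a; rewrite !id_lfunE.
have [e e1 eA] : exists2 e : A, counit H e = 1 & forall a, e * a = counit H a *: e.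
  exists (h (1 : K^o)).
    by have /lfunP/(_ (1 : K^o)) := he; rewrite comp_lfunE id_lfunE.
  move=> a; have := hA (1 : K^o) a => /= <-.
  by rewrite linearZ.
have re : right_ideal <[e]>%VS.
  apply/right_idealP => _ a /vlineP[k ->]; rewrite -scalerAl eA.
  by rewrite !memvZ ?memv_line.
have [<-|pe] := pselect (<[e]>%VS = fullv).
  rewrite dim_vline; case: eqP => // e0.
  by have /eqP := e1; rewrite e0 linear0 eq_sym oner_eq0.
have /subvP/(_ e (memv_line e)) := proper_sub_aug H A_local re pe.
by rewrite (mem_aug H) e1 oner_eq0.
Qed.

End Trivial.

(** * The value of Delta *)

Lemma phi_eq1 (R : realType) (K : fieldType) (A : falgType K) (M : rmodule A) :
  Ext 1 M M <> 0%VS -> phi R M = 1%E.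
Proof.
move=> ext1; apply/eqP; rewrite eq_le; apply/andP; split.
  by apply: ereal_inf_lbound; exists 1%N.
apply: le_ereal_inf_tmp => _ [r [r1 _] <-].
by rewrite lee_fin Num.Theory.ler1n.
Qed.

Theorem theorem3p8 (R : realType) (K : fieldType) (A : falgType K)
    (H : hopf_structure A)
    (A_local : local_algebra A) (A_nonsemisimple : ~ semisimple_algebra A) :
  Delta R A = 1%E /\
  (forall M : rmodule A, ~ projective M -> Ext 1 M M <> 0%VS).
Proof.
have ext1 (M : rmodule A) : ~ projective M -> Ext 1 M M <> 0%VS.
  by move=> nM ext0; apply: nM; apply: (Ext1_eq0_projective H A_local).
split=> //; apply/eqP; rewrite eq_le; apply/andP; split.
  by apply: ge_ereal_sup => _ [M [/ext1 eM ->]]; rewrite phi_eq1.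
have nK := @trivial_not_projective _ _ H A_local A_nonsemisimple.
apply: ereal_sup_ubound; exists (trivial_module H); split=> //.
by rewrite phi_eq1 //; apply: ext1.
Qed.
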